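(* Let $f:\mathbb{R}^n\to\mathbb{R}$ be locally Lipschitz and weakly upper semismooth. Then Algorithm A (the two-point line search defined in the context) terminates after finitely many iterations.
   Context: Notation: $\|\cdot\|$ is the Euclidean norm. $\partial f(\bm x)$ is the Clarke subdifferential: the convex hull of all limits $\lim_i\nabla f(\bm x_i)$ with $\bm x_i\to\bm x$ and $f$ differentiable at each $\bm x_i$. Weakly upper semismooth: for any $\bm z,\bm d\in\mathbb{R}^n$ and any sequences $\{\boldsymbol\xi_i\}_i\subset\mathbb{R}^n$, $\{h_i\}_i\subset(0,\infty)$ with $h_i\downarrow0$ and $\boldsymbol\xi_i\in\partial f(\bm z+h_i\bm d)$, one has $\limsup_{i\to\infty}\boldsymbol\xi_i^T\bm d\ge\liminf_{i\to\infty}\frac{f(\bm z+h_i\bm d)-f(\bm z)}{h_i}$. Algorithm A (two-point line search). Inputs: $\varepsilon\in(0,1)$, a point $\bm x\in\mathbb{R}^n$, and a direction $\bm d=-\bm g^*/\|\bm g^*\|$ with $\bm g^*\in\mathbb{R}^n\setminus\{\bm 0\}$. Parameters: $\beta_1,\beta_2\in(0,1)$ with $\beta_1<\beta_2$, $\zeta\in(0,0.5)$, $\bar t\in(0,\varepsilon)$, $p\in\mathbb{N}$. Output: $\bm s\in\mathbb{R}^n$ and an indicator $\mathrm I\in\{0,1\}$. Initialization: choose any $t_0\in(\bar t,\varepsilon)$, set $\bar t_0:=1$, compute any $\boldsymbol\xi_0\in\partial f(\bm x+t_0\bm d)$, set $t_0^l:=0$, $t_0^u:=\varepsilon$, $i:=0$.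 Iteration $i$ consists of the following steps in order: (1) if $f(\bm x+t_i\bm d)-f(\bm x)\le-\beta_1t_i\|\bm g^*\|$, set $t_{i+1}^l:=t_i$, $t_{i+1}^u:=t_i^u$; else set $t_{i+1}^l:=t_i^l$, $t_{i+1}^u:=t_i$. (2) If $f(\bm x+\bar t_i\bm d)-f(\bm x)\le-\beta_1\bar t_i\|\bm g^*\|$ and $\bar t_i\ge\bar t$, return $\mathrm I:=1$, $\bm s:=\bm x+\bar t_i\bm d$ and stop. (3) If $\boldsymbol\xi_i^T\bm d\ge-\beta_2\|\bm g^*\|$, return $\mathrm I:=0$, $\bm s:=\boldsymbol\xi_i$ and stop. (4) Choose any $t_{i+1}\in[t_{i+1}^l+\zeta(t_{i+1}^u-t_{i+1}^l),\,t_{i+1}^u-\zeta(t_{i+1}^u-t_{i+1}^l)]$, set $\bar t_{i+1}:=\left(\exp\left(\frac{\log t_0}{p}\right)\right)^{i+1}$, compute any $\boldsymbol\xi_{i+1}\in\partial f(\bm x+t_{i+1}\bm d)$, set $i:=i+1$, and repeat. *)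

(* Defs.v *)
From HB Require Import structures.
From mathcomp Require Import all_boot all_order all_algebra.
From mathcomp Require Import all_classical all_reals all_analysis.
Set Implicit Arguments.
Unset Strict Implicit.
Unset Printing Implicit Defensive.
Import Order.TTheory GRing.Theory Num.Theory.
Import numFieldNormedType.Exports.
Local Open Scope classical_set_scope.
Local Open Scope ring_scope.

Definition dotv (R : realType) (n : nat) (u v : 'rV[R]_n) : R :=
  \sum_i u 0 i * v 0 i.

(* The library norm on ['rV[R]_n] is the sup norm, hence this definition; both
   norms induce the library topology used for limits and differentiability. *)
Definition enorm (R : realType) (n : nat) (u : 'rV[R]_n) : R :=
  Num.sqrt (dotv u u).

Definition grad (R : realType) (n : nat) (f : 'rV[R]_n -> R) (x : 'rV[R]_n) :
    'rV[R]_n :=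
  \row_i 'D_(delta_mx 0 i) f x.

Definition locally_lipschitz (R : realType) (n : nat) (f : 'rV[R]_n -> R) :=
  forall x : 'rV[R]_n, exists L : R,
    \forall y & z \near x, `|f y - f z| <= L * enorm (y - z).

Definition limiting_gradients (R : realType) (n : nat) (f : 'rV[R]_n -> R)
    (x : 'rV[R]_n) : set 'rV[R]_n :=
  [set v | exists u : nat -> 'rV[R]_n,
     [/\ u @ \oo --> x,
         (forall i, differentiable f (u i)) &
         (fun i => grad f (u i)) @ \oo --> v]].

Definition clarke_subdiff (R : realType) (n : nat) (f : 'rV[R]_n -> R)
    (x : 'rV[R]_n) : set 'rV[R]_n :=
  smallest (@convex_set R 'rV[R]_n) (limiting_gradients f x).

(* The upper and lower limits are taken in the extended reals, so that no
   boundedness of the two sequences is presupposed. *)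
Definition weakly_upper_semismooth (R : realType) (n : nat)
    (f : 'rV[R]_n -> R) :=
  forall (z d : 'rV[R]_n) (xi : nat -> 'rV[R]_n) (h : nat -> R),
    (forall i, 0 < h i) -> nonincreasing_seq h -> h @ \oo --> (0 : R) ->
    (forall i, clarke_subdiff f (z + h i *: d) (xi i)) ->
    (limn_einf (fun i => ((f (z + h i *: d) - f z) / h i)%:E)
     <= limn_esup (fun i => (dotv (xi i) d)%:E))%E.

(* Variables of the line search at the beginning of iteration [ls_iter]:
   t_i, t_i^l, t_i^u, \bar t_i and xi_i. *)
Record ls_state (R : realType) (n : nat) := LSState {
  ls_iter : nat;
  ls_t : R;
  ls_tl : R;
  ls_tu : R;
  ls_tb : R;
  ls_xi : 'rV[R]_n }.

Section TwoPointLineSearch.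
Variables (R : realType) (n : nat) (f : 'rV[R]_n -> R).
Variables (eps : R) (x g : 'rV[R]_n).
Variables (beta1 beta2 zeta tbar : R) (p : nat).
Implicit Types s : ls_state R n.

Definition ls_dir : 'rV[R]_n := - ((enorm g)^-1 *: g).

Definition sufficient_decrease (t : R) : bool :=
  f (x + t *: ls_dir) - f x <= - beta1 * t * enorm g.

Definition ls_tl' s : R := if sufficient_decrease (ls_t s) then ls_t s else ls_tl s.
Definition ls_tu' s : R := if sufficient_decrease (ls_t s) then ls_tu s else ls_t s.

Definition ls_step_found s : bool :=
  sufficient_decrease (ls_tb s) && (tbar <= ls_tb s).
Definition ls_curvature s : bool := - beta2 * enorm g <= dotv (ls_xi s) ls_dir.

Definition ls_initial (t0 : R) s : Prop :=
  tbar < t0 < eps /\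
  exists2 xi0, clarke_subdiff f (x + t0 *: ls_dir) xi0 &
    s = LSState 0 t0 0 eps 1 xi0.

(* The test on the geometric trial step has priority over the one on the
   subgradient. The indicator 1 is encoded by [I = true]. *)
Definition ls_returns s (I : bool) (v : 'rV[R]_n) : Prop :=
  if ls_step_found s then I = true /\ v = x + ls_tb s *: ls_dir
  else [/\ ls_curvature s, I = false & v = ls_xi s].

(* A relation, because the new step length and subgradient are free choices. *)
Definition ls_continues (t0 : R) s s' : Prop :=
  [/\ ~~ ls_step_found s, ~~ ls_curvature s &
   exists t xi,
   [/\ ls_tl' s + zeta * (ls_tu' s - ls_tl' s) <= t
         <= ls_tu' s - zeta * (ls_tu' s - ls_tl' s),
       clarke_subdiff f (x + t *: ls_dir) xi &
       s' = LSState (ls_iter s).+1 t (ls_tl' s) (ls_tu' s)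
              (expR (ln t0 / p%:R) ^+ (ls_iter s).+1) xi]].

(* An execution is a sequence of states following the iteration for as long as
   it does not stop; the states after a stop are irrelevant. *)
Definition ls_execution (t0 : R) (run : nat -> ls_state R n) : Prop :=
  ls_initial t0 (run 0%N) /\
  forall i, (exists I v, ls_returns (run i) I v) \/
            ls_continues t0 (run i) (run i.+1).

Definition ls_terminates : Prop :=
  forall (t0 : R) (run : nat -> ls_state R n), ls_execution t0 run ->
  exists N : nat,
    (forall i, (i < N)%N -> ls_continues t0 (run i) (run i.+1)) /\
    exists I v, ls_returns (run N) I v.

End TwoPointLineSearch.

(* Main.v *)
(* Suppose that the line search never stops, and call [t] good if it satisfies
   the sufficient decrease test.  The trial step of index [p] of the geometric
   sequence is [t0], so [t0] is not good, and from the first update on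
   the upper end of the bracketing interval is a tested step that is not good
   and at which the curvature test failed.  The interval shrinks to
   some [a], which is good by continuity of [f], so the upper ends decrease to
   [a] while staying different from it.  From [a] to the upper ends the
   difference quotients of [f] exceed [- beta1 * enorm g], whereas the chosen
   subgradients have slope below [- beta2 * enorm g]: this contradicts weak
   upper semismoothness at [x + a d]. *)
Require Import Defs.
From HB Require Import structures.
From mathcomp Require Import all_boot all_order all_algebra.
From mathcomp Require Import all_classical all_reals all_analysis.
From mathcomp Require Import ring lra.
Import Order.TTheory GRing.Theory Num.Theory.
Import numFieldNormedType.Exports.
Local Open Scope classical_set_scope.
Local Open Scope ring_scope.

(** The upper limit is an infimum of suprema over the members of the filter, and the full index set
    is one of them. *)
Lemma limn_esup_ub {R : realType} (u : nat -> \bar R) (c : \bar R) :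
  (forall i, u i <= c)%E -> (limn_esup u <= c)%E.
Proof.
move=> uc; rewrite /limn_esup /limf_esup.
apply: (@le_trans _ _ (ereal_sup (u @` setT)%classic)).
  by apply: ereal_inf_lbound; exists setT => //; exact: filterT.
by apply: ge_ereal_sup => _ [i _ <-].
Qed.

Lemma limn_einf_lb {R : realType} (u : nat -> \bar R) (c : \bar R) :
  (forall i, c <= u i)%E -> (c <= limn_einf u)%E.
Proof.
move=> cu; rewrite /limn_einf leeNr; apply: limn_esup_ub => i.
by rewrite leeN2.
Qed.

Lemma enormZ {R : realType} {n : nat} (a : R) (u : 'rV[R]_n) :
  enorm (a *: u) = `|a| * enorm u.
Proof.
rewrite /enorm -sqrtr_sqr -sqrtrM ?sqr_ge0//; congr Num.sqrt.
by rewrite /dotv mulr_sumr; apply: eq_bigr => i _; rewrite !mxE; ring.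
Qed.

Lemma enorm_gt0 {R : realType} {n : nat} (u : 'rV[R]_n) :
  u != 0 -> 0 < enorm u.
Proof.
move=> u0; rewrite /enorm sqrtr_gt0 lt_neqAle.
have sq_ge0 i : true -> 0 <= u 0 i * u 0 i by rewrite -expr2 sqr_ge0.
rewrite sumr_ge0// andbT eq_sym /dotv psumr_eq0//; apply: contra u0.
move=> /allP ui0; apply/eqP/rowP => i; rewrite mxE; apply/eqP.
by have := ui0 i (mem_index_enum i); rewrite /= mulf_eq0 orbb.
Qed.

(** The Lipschitz estimate near [x + a *: d], with that point as second argument, bounds the
    increment by a multiple of the distance from [t] to [a]; this tends to 0 whatever the sign of
    [L]. *)
Lemma locally_lipschitz_continuous_line {R : realType} {n : nat}
    (f : 'rV[R]_n -> R) (x d : 'rV[R]_n) :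
  locally_lipschitz f -> continuous (fun t : R => f (x + t *: d)).
Proof.
move=> f_lip a; have [L [[A B] /= [nA nB] fL]] := f_lip (x + a *: d).
have line_cvg : (fun t : R => x + t *: d) @ a --> x + a *: d.
  by apply: cvgD; [exact: cvg_cst | apply: cvgZr_tmp; exact: cvg_id].
apply/cvgrPdistC_le => e e0.
have bound_cvg : (fun t : R => L * (`|t - a| * enorm d)) @ a --> (0 : R).
  rewrite -(mulr0 L) -(mul0r (enorm d)) -(normr0 R) -(subrr a).
  apply: cvgMl_tmp; apply: cvgMr_tmp; apply: cvg_norm.
  by apply: cvgB; [exact: cvg_id | exact: cvg_cst].
near=> t.
have At : A (x + t *: d) by near: t; exact: line_cvg.
have := fL (x + t *: d, x + a *: d) (conj At (nbhs_singleton nB)) => /=.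
rewrite opprD addrACA subrr add0r -scalerBl enormZ distrC => /le_trans; apply.
apply: ltW; near: t; exact: (cvgr_lt 0).
Unshelve. all: by end_near. Qed.

(** The limit argument freed from the algorithm: [c1] and [c2] stand for [- beta1 * enorm g] and
    [- beta2 * enorm g]. The steps fed to weak upper semismoothness at [x + a *: d] are
    [up i - a]. *)
Lemma weakly_upper_semismooth_bracket {R : realType} {n : nat}
    {f : 'rV[R]_n -> R} {x d : 'rV[R]_n} {c1 c2 a : R} {lo up : nat -> R}
    {xi : nat -> 'rV[R]_n} :
  locally_lipschitz f -> weakly_upper_semismooth f ->
  lo @ \oo --> a -> up @ \oo --> a -> nonincreasing_seq up ->
  (forall i, f (x + lo i *: d) - f x <= c1 * lo i) ->
  (forall i, c1 * up i < f (x + up i *: d) - f x) ->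
  (forall i, clarke_subdiff f (x + up i *: d) (xi i)) ->
  (forall i, dotv (xi i) d <= c2) ->
  c1 <= c2.
Proof.
move=> f_lip f_wus lo_a up_a up_ni lo_good up_bad xi_sub xi_le.
have a_good : f (x + a *: d) - f x <= c1 * a.
  have f_lo : f (x + lo i *: d) @[i --> \oo] --> f (x + a *: d).
    apply: (@continuous_cvg _ _ _ _ _ lo (fun t : R => f (x + t *: d))) => //.
    exact: locally_lipschitz_continuous_line.
  apply: (@ler_cvg_to _ \oo _ _ (fun i => f (x + lo i *: d) - f x)
    (fun i => c1 * lo i)).
  - by apply: cvgB; [exact: f_lo | exact: cvg_cst].
  - exact: cvgMl_tmp.
  - exact: nearW.
(* Monotonicity only gives [a <= up i]; equality is excluded because [a] satisfies the inequality
   that [up i] violates. *)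
have up_gt i : a < up i.
  rewrite lt_neqAle; apply/andP; split.
    by apply: contraTneq a_good => ->; rewrite -ltNge.
  rewrite -(cvg_lim _ up_a)//; apply: nonincreasing_cvgn_ge => //.
  exact: cvgP up_a.
have line_eq i : x + a *: d + (up i - a) *: d = x + up i *: d.
  by rewrite -addrA -scalerDl (addrC a) subrK.
have h_gt0 i : 0 < up i - a by rewrite subr_gt0.
have h_ni : nonincreasing_seq (fun i => up i - a).
  by move=> i j ij; rewrite lerB // up_ni.
have h_cvg : (fun i => up i - a) @ \oo --> (0 : R).
  by rewrite -(subrr a); apply: cvgB => //; exact: cvg_cst.
have wus : forall i, clarke_subdiff f (x + a *: d + (up i - a) *: d) (xi i).
  by move=> i; rewrite line_eq.
rewrite -lee_fin; apply: le_trans (le_trans (f_wus _ _ _ _ h_gt0 h_ni h_cvg wus) _).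
(* Subtracting [a_good] from [up_bad i] bounds the increment from [a] to [up i] below by
   [c1 * (up i - a)]. *)
- apply: limn_einf_lb => i; rewrite lee_fin ler_pdivlMr// line_eq.
  by have := up_bad i; lra.
- by apply: limn_esup_ub => i; rewrite lee_fin.
Qed.

Theorem theorem3p3 (R : realType) (n : nat) (f : 'rV[R]_n -> R)
    (f_lip : locally_lipschitz f) (f_wus : weakly_upper_semismooth f)
    (eps : R) (x g : 'rV[R]_n) (beta1 beta2 zeta tbar : R) (p : nat)
    (eps01 : 0 < eps < 1) (g_neq0 : g != 0)
    (beta1_01 : 0 < beta1 < 1) (beta2_01 : 0 < beta2 < 1)
    (beta12 : beta1 < beta2) (zeta_bnd : 0 < zeta < 1 / 2)
    (tbar_bnd : 0 < tbar < eps) (p_gt0 : (0 < p)%N) :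
  ls_terminates f eps x g beta1 beta2 zeta tbar p.
Proof.
move=> t0 run [init step].
pose stops i := exists I v, ls_returns f x g beta1 beta2 tbar (run i) I v.
have [[k stop_k]|never] := pselect (exists k, stops k).
  have ex_stop : exists k, `[< stops k >] by exists k; apply/asboolP.
  (* The least stopping index serves as [N], since every earlier iteration must continue. *)
  case: (ex_minnP ex_stop) => N /asboolP stop_N N_min.
  exists N; split => // i iN; case: (step i) => // /asboolP/N_min.
  by rewrite leqNgt iN.
have {}step i : ls_continues f x g beta1 beta2 zeta tbar p t0 (run i) (run i.+1).
  by case: (step i) => // stop_i; case: never; exists i.
exfalso; case: init => t0_bnd [xi0 xi0_sub run0].
have gpos := enorm_gt0 g g_neq0.
set d := ls_dir g in xi0_sub.
pose good t := sufficient_decrease f x g beta1 t.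
have tb_run i : ls_tb (run i) = expR (ln t0 / p%:R) ^+ i /\ ls_iter (run i) = i.
  elim: i => [|i [_ iter_i]]; first by rewrite run0 expr0.
  by case: (step i) => _ _ [t [xi [_ _ ->]]] /=; rewrite iter_i.
have t0_gt0 : 0 < t0 by lra.
(* Iteration [p] tests the trial step [t0]; as [tbar < t0], only the decrease condition can have
   failed. *)
have t0_bad : ~~ good t0.
  case: (step p) => + _ _; rewrite /ls_step_found (tb_run p).1.
  have -> : expR (ln t0 / p%:R) ^+ p = t0.
    by rewrite -expRM_natr divfK ?lnK ?pnatr_eq0 -?lt0n.
  by rewrite negb_and -ltNge => /orP[//|]; lra.
have xi_run i : clarke_subdiff f (x + ls_t (run i) *: d) (ls_xi (run i)).
  case: i => [|i]; first by rewrite run0.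
  by case: (step i) => _ _ [t [xi [_ xi_sub ->]]].
have slope_run i : dotv (ls_xi (run i)) d <= - beta2 * enorm g.
  by case: (step i) => _; rewrite /ls_curvature -ltNge => /ltW.
(* The shift by one skips the initial upper end [eps], which need not be a tested step. *)
pose lo i := ls_tl (run i.+1); pose up i := ls_tu (run i.+1).
have lo0 : lo 0%N = 0 /\ up 0%N = t0.
  rewrite /lo /up; case: (step 0%N) => _ _ [t [xi [_ _ ->]]] /=.
  by rewrite /ls_tl' /ls_tu' run0 /= -/(good t0) (negbTE t0_bad).
have loS i : lo i.+1 = ls_tl' f x g beta1 (run i.+1).
  by rewrite /lo; case: (step i.+1) => _ _ [t [xi [_ _ ->]]].
have upS i : up i.+1 = ls_tu' f x g beta1 (run i.+1).
  by rewrite /up; case: (step i.+1) => _ _ [t [xi [_ _ ->]]].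
have t_bnd i : lo i + zeta * (up i - lo i) <= ls_t (run i.+1)
    <= up i - zeta * (up i - lo i).
  by rewrite /lo /up; case: (step i) => _ _ [t [xi [+ _ ->]]].
(* The trial step keeps a fraction [zeta] of the bracket away from both ends, so either update
   removes at least that fraction. *)
have len_run i : 0 <= up i - lo i <= geometric t0 (1 - zeta) i.
  elim: i => [|i IH]; first by rewrite lo0.1 lo0.2 /= subr0 expr0 mulr1 lexx ltW.
  have {IH} /andP[len_ge0 len_le] := IH.
  have : (1 - zeta) * (up i - lo i) <= geometric t0 (1 - zeta) i.+1.
    by rewrite /= exprS mulrCA ler_wpM2l//; lra.
  move: (t_bnd i); rewrite loS upS /ls_tl' /ls_tu' -/(lo i) -/(up i).
  have : 0 <= zeta * (up i - lo i) by rewrite mulr_ge0//; lra.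
  by case: ifP => _ zlen_ge0 t_i len_le'; apply/andP; split; lra.
have mono i : lo i <= lo i.+1 /\ up i.+1 <= up i.
  have /andP[len_ge0 _] := len_run i.
  have zlen_ge0 : 0 <= zeta * (up i - lo i) by rewrite mulr_ge0//; lra.
  move: (t_bnd i); rewrite loS upS /ls_tl' /ls_tu' -/(lo i) -/(up i).
  by case: ifP => _ t_i; split; lra.
(* At step 0 the test reads [0 <= 0]; afterwards the lower end only moves to steps that pass it. *)
have good_lo i : good (lo i).
  elim: i => [|i IH].
    by rewrite lo0.1 /good /sufficient_decrease scale0r addr0 subrr mulr0 mul0r.
  by rewrite loS /ls_tl'; case: ifP.
(* The subgradient stays attached to the upper end: it dates from the iteration that tested this
   step, possibly long before [i]. *)
have bad_up i : ~~ good (up i) /\ exists xi,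
    clarke_subdiff f (x + up i *: d) xi /\ dotv xi d <= - beta2 * enorm g.
  elim: i => [|i IH].
    rewrite lo0.2; split => //; exists (ls_xi (run 0%N)).
    by split => //; rewrite run0.
  rewrite upS /ls_tu'; case: ifPn => // bad_i; split => //.
  by exists (ls_xi (run i.+1)).
have /choice[xi xiP] := fun i => (bad_up i).2.
have up_ni : nonincreasing_seq up by apply/nonincreasing_seqP => i; exact: (mono i).2.
have lo_ge0 i : 0 <= lo i.
  by elim: i => [|i /le_trans]; [rewrite lo0.1 | apply; exact: (mono i).1].
have up_cvg : up @ \oo --> limn up.
  apply: nonincreasing_is_cvgn => //; exists 0 => _ [i _ <-].
  by have := len_run i; have := lo_ge0 i; lra.
have len_cvg : (fun i => up i - lo i) @ \oo --> (0 : R).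
  apply: (@squeeze_cvgr _ \oo _ _ (cst 0) (geometric t0 (1 - zeta))).
  - exact: nearW.
  - exact: cvg_cst.
  - by apply: cvg_geometric; rewrite ger0_norm; lra.
have lo_cvg : lo @ \oo --> limn up.
  rewrite -[limn up]subr0 (_ : lo = (fun i => up i - (up i - lo i))).
    exact: cvgB.
  by apply/funext => i; rewrite subKr.
have good_le t : good t = (f (x + t *: d) - f x <= - beta1 * enorm g * t).
  by rewrite /good /sufficient_decrease mulrAC.
(* Dividing by [enorm g > 0] will give [beta2 <= beta1], against [beta12]. *)
have : - beta1 * enorm g <= - beta2 * enorm g.
  apply: (weakly_upper_semismooth_bracket f_lip f_wus lo_cvg up_cvg up_ni
    (x := x) (d := d) (xi := xi)) => i.
  - by rewrite -good_le.
  - by rewrite ltNge -good_le; exact: (bad_up i).1.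
  - exact: (xiP i).1.
  - exact: (xiP i).2.
by rewrite ler_pM2r// lerN2 leNgt beta12.
Qed.
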